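(* Let $n\ge 1$ and $s\ge 0$ be integers and $0\le\epsilon\le 1$. For any probabilistic $s$-bit entanglement distillation protocol $\mathcal{P}$ on $n$ input qubit pairs with ideal success probability $p$, the conditional fidelity of $\mathcal P$ with respect to the fidelity error model $\mathcal{M}^{\mathsf f}_{n,\epsilon}$ of parameter $\epsilon$ satisfies $$F^c_{\mathcal{M}^{\mathsf f}_{n,\epsilon}}(\mathcal{P})\;\le\; 1-\frac{\epsilon\, p}{2^{s+1}}.$$
   Context: Notation. Alice and Bob each hold $n$ qubits, forming $n$ qubit pairs. $\Phi^+=\frac{1}{\sqrt2}(|0\rangle^A|0\rangle^B+|1\rangle^A|1\rangle^B)$, and $\Psi_m=(\Phi^+)^{\otimes m}$ denotes $m$ perfect EPR pairs (also its density matrix). For a state $\sigma$ of $m$ qubit pairs, its fidelity is $F(\sigma)=\langle\Psi_m|\sigma|\Psi_m\rangle$. Fidelity error model. $\mathcal{M}^{\mathsf f}_{n,\epsilon}$ is the set of all density matrices $\rho$ of $n$ qubit pairs (dimension $2^{2n}$) with $F(\rho)\ge 1-\epsilon$. Protocols. A deterministic $s$-bit protocol acts on a state $\rho$ of $n$ qubit pairs shared by Alice and Bob, each of whom may use private ancillary qubits initialized to $|0\rangle$. It proceeds in $s$ rounds; in each round one of the two parties, as specified by the protocol, performs a local quantum operation (possibly including measurements, and possibly depending on the classical bits exchanged so far) on his or her own qubits and sends one classical bit to the other party. At the end each party performs a local operation and outputs $m$ qubits ($m\ge1$), the resulting $m$ qubit pairs being the output; in addition Alice, as a result of her local operation, outputs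 a symbol SUCC or FAIL (this symbol is not counted as communication). In a probabilistic protocol Alice and Bob additionally share a classical random string, independent of the input, on which all their operations may depend. No auxiliary entanglement and no quantum channel between the parties is allowed. The success probability of $\mathcal P$ on $\rho$ is the probability that Alice outputs SUCC (over all randomness, including the shared string). The ideal success probability of $\mathcal P$ is its success probability on input $\Psi_n$. The conditional output $\mathcal P^c(\rho)$ is the density matrix of the output conditioned on Alice outputting SUCC, defined when the success probability on $\rho$ is positive. The conditional fidelity with respect to an error model $\mathcal M$ is $F^c_{\mathcal M}(\mathcal P)=\min_{\rho\in\mathcal M}F(\mathcal P^c(\rho))$, read as the infimum in $[0,1]$ over those $\rho\in\mathcal M$ on which the success probability is positive (equal to $1$ if there are none). *)

(* Defs.v *)
From HB Require Import structures.
From mathcomp Require Import all_boot all_order all_algebra.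
From mathcomp Require Import sesquilinear spectral.
From mathcomp Require Import complex mxtens.
From mathcomp Require Import boolp classical_sets reals.
Set Implicit Arguments.
Unset Strict Implicit.
Unset Printing Implicit Defensive.
Import Order.TTheory GRing.Theory Num.Theory.
Local Open Scope classical_set_scope.
Local Open Scope ring_scope.
Local Open Scope complex_scope.
Local Open Scope sesquilinear_scope.

Definition psdmx (R : realType) (d : nat) (A : 'M[R[i]]_d) : Prop :=
  A ^t* = A /\ forall v : 'cV[R[i]]_d, 0 <= (v ^t* *m A *m v) 0 0.

Definition density (R : realType) (d : nat) (rho : 'M[R[i]]_d) : Prop :=
  psdmx rho /\ \tr rho = 1.

(* States of n qubit pairs are matrices of dimension 2 ^ n * 2 ^ n: all of
   Alice's qubits first, then all of Bob's. Qubit i of the basis vector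
   numbered x of a register is the binary digit of weight 2 ^ i of x. *)
Definition bit (d : nat) (x : 'I_d) (i : nat) : 'I_2 := inord (odd (x %/ 2 ^ i)).

Definition ket (R : realType) (b : 'I_2) : 'cV[R[i]]_2 := delta_mx b 0.

Definition PhiPlus (R : realType) : 'cV[R[i]]_(2 * 2) :=
  (sqrtC 2)^-1 *: (ket R 0 *t ket R 0 + ket R 1 *t ket R 1).

(* The tensor power of PhiPlus, with the 2m qubits regrouped so that Alice's
   come first: the amplitude of |x>|y> is the product over the pairs i of the
   amplitudes of |x_i>|y_i> in PhiPlus. *)
Definition EPR (R : realType) (m : nat) : 'cV[R[i]]_(2 ^ m * 2 ^ m) :=
  \col_k \prod_(i < m)
    PhiPlus R (mxtens_index (bit (mxtens_unindex k).1 i,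
                             bit (mxtens_unindex k).2 i)) 0.

Definition EPR_density (R : realType) (m : nat) : 'M[R[i]]_(2 ^ m * 2 ^ m) :=
  EPR R m *m (EPR R m) ^t*.

Definition fidelity (R : realType) (m : nat)
    (sigma : 'M[R[i]]_(2 ^ m * 2 ^ m)) : R :=
  complex.Re (((EPR R m) ^t* *m sigma *m EPR R m) 0 0).

Definition fidelity_model (R : realType) (n : nat) (eps : R) :
    set 'M[R[i]]_(2 ^ n * 2 ^ n) :=
  [set rho | density rho /\ 1 - eps <= fidelity rho].
Arguments fidelity_model {R} n eps _.

(* A quantum operation with a classical outcome in O, in operator-sum form:
   outcome o turns the state sigma into the unnormalized state
   \sum_j K o j sigma (K o j)^*. Outcomes that the party keeps private are
   stored in its register. *)
Record instrument (R : realType) (O : finType) (d d' : nat) := Instrument {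
  kraus_num : nat;
  kraus : O -> 'I_kraus_num -> 'M[R[i]]_(d', d);
  kraus_complete : \sum_o \sum_j (kraus o j) ^t* *m kraus o j = 1%:M
}.
Arguments kraus {R O d d'} _ _ _.

Definition apply_Alice (R : realType) (O : finType) (d d' e : nat)
    (K : instrument R O d d') (o : O) (sigma : 'M[R[i]]_(d * e)) :
    'M[R[i]]_(d' * e) :=
  \sum_j (kraus K o j *t (1%:M : 'M_e)) *m sigma
         *m (kraus K o j *t (1%:M : 'M_e)) ^t*.

Definition apply_Bob (R : realType) (O : finType) (d e e' : nat)
    (K : instrument R O e e') (o : O) (sigma : 'M[R[i]]_(d * e)) :
    'M[R[i]]_(d * e') :=
  \sum_j ((1%:M : 'M_d) *t kraus K o j) *m sigma
         *m ((1%:M : 'M_d) *t kraus K o j) ^t*.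

(* The rounds of a protocol with s bits of communication, on registers of
   dimensions dA and dB. The outcome of a round's operation is the bit sent;
   the rest of the protocol is a function of it. In the final operations each
   party outputs m qubits, and Alice's outcome is SUCC (true) or FAIL (false). *)
Inductive rounds (R : realType) (dA dB m : nat) : nat -> Type :=
| Final of instrument R bool dA (2 ^ m) & instrument R unit dB (2 ^ m) :
    rounds R dA dB m 0
| AliceRound s of instrument R bool dA dA & (bool -> rounds R dA dB m s) :
    rounds R dA dB m s.+1
| BobRound s of instrument R bool dB dB & (bool -> rounds R dA dB m s) :
    rounds R dA dB m s.+1.

(* The unnormalized output state on the event that Alice outputs r, summed over
   all transcripts. *)
Fixpoint run (R : realType) (dA dB m s : nat) (P : rounds R dA dB m s)
    (r : bool) : 'M[R[i]]_(dA * dB) -> 'M[R[i]]_(2 ^ m * 2 ^ m) :=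
  match P with
  | Final K L => fun sigma => apply_Bob L tt (apply_Alice K r sigma)
  | AliceRound _ K next =>
      fun sigma => \sum_(c : bool) run (next c) r (apply_Alice K c sigma)
  | BobRound _ L next =>
      fun sigma => \sum_(c : bool) run (next c) r (apply_Bob L c sigma)
  end.

Record det_protocol (R : realType) (n m s : nat) := DetProtocol {
  ancA : nat;
  ancB : nat;
  det_rounds : rounds R (2 ^ n * 2 ^ ancA) (2 ^ n * 2 ^ ancB) m s
}.

(* The isometry |x> |-> |x>|0...0> that adjoins a ancillary qubits. *)
Definition add_ancilla (R : realType) (n a : nat) :
    'M[R[i]]_(2 ^ n * 2 ^ a, 2 ^ n) :=
  \matrix_(k, j) (((mxtens_unindex k).1 == j)
                  && ((mxtens_unindex k).2 == 0 :> nat))%:R.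

Definition init_state (R : realType) (n a b : nat)
    (rho : 'M[R[i]]_(2 ^ n * 2 ^ n)) :
    'M[R[i]]_((2 ^ n * 2 ^ a) * (2 ^ n * 2 ^ b)) :=
  (add_ancilla R n a *t add_ancilla R n b) *m rho
  *m (add_ancilla R n a *t add_ancilla R n b) ^t*.

(* The shared random string w has an arbitrary distribution on a finite set. *)
Record prob_protocol (R : realType) (n m s : nat) := ProbProtocol {
  rand_string : finType;
  rand_prob : rand_string -> R;
  rand_prob_ge0 : forall w, 0 <= rand_prob w;
  rand_prob_sum1 : \sum_w rand_prob w = 1;
  protocol_at : rand_string -> det_protocol R n m s
}.
Arguments rand_prob {R n m s} _ _.
Arguments protocol_at {R n m s} _ _.

Definition success_state (R : realType) (n m s : nat)
    (P : prob_protocol R n m s) (rho : 'M[R[i]]_(2 ^ n * 2 ^ n)) :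
    'M[R[i]]_(2 ^ m * 2 ^ m) :=
  \sum_w (rand_prob P w)%:C
    *: run (det_rounds (protocol_at P w)) true
         (init_state (ancA (protocol_at P w)) (ancB (protocol_at P w)) rho).

Definition success_prob (R : realType) (n m s : nat)
    (P : prob_protocol R n m s) (rho : 'M[R[i]]_(2 ^ n * 2 ^ n)) : R :=
  complex.Re (\tr (success_state P rho)).

Definition ideal_success_prob (R : realType) (n m s : nat)
    (P : prob_protocol R n m s) : R :=
  success_prob P (EPR_density R n).

Definition cond_output (R : realType) (n m s : nat)
    (P : prob_protocol R n m s) (rho : 'M[R[i]]_(2 ^ n * 2 ^ n)) :
    'M[R[i]]_(2 ^ m * 2 ^ m) :=
  (\tr (success_state P rho))^-1 *: success_state P rho.

Definition cond_fidelity (R : realType) (n m s : nat)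
    (M : set 'M[R[i]]_(2 ^ n * 2 ^ n)) (P : prob_protocol R n m s) : R :=
  let S := [set fidelity (cond_output P rho)
           | rho in M `&` [set rho | 0 < success_prob P rho]] in
  if `[< S !=set0 >] then inf S else 1.

(* Main.v *)
(* Let the adversary supply [rho = (1 - eps) Psi_n + eps I / N^2], [N = 2^n].
   A deterministic protocol is a sum, over its 2^s transcripts, of product maps
   with Kraus families [A_i], [B_j] that satisfy [\sum_i A_i^* A_i <= 1] and
   [\sum_j B_j^* B_j <= 1]. Writing |.| for the Frobenius norm, a transcript
   succeeds on [Psi_n] with probability
   [p_t = N^-1 \sum_(i, j) |A_i B_j^T|^2], which is at most
   [N^-1 \sum_i |A_i|^2] and at most [N^-1 \sum_j |B_j|^2]; on [I / N^2] it
   succeeds with probability the product of these two bounds, hence at least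
   [p_t^2]. Cauchy-Schwarz over transcripts and shared strings gives success
   probability [q >= p^2 / 2^s] on [I / N^2], where the output is separable and
   has fidelity at most 2^-m <= 1/2. *)
Require Import Defs.
From HB Require Import structures.
From mathcomp Require Import all_boot all_order all_algebra.
From mathcomp Require Import sesquilinear spectral.
From mathcomp Require Import complex mxtens.
From mathcomp Require Import boolp classical_sets reals.
From mathcomp Require Import ring lra.
Import Order.TTheory GRing.Theory Num.Theory.
Local Open Scope ring_scope.
Set Implicit Arguments.
Unset Strict Implicit.
Unset Printing Implicit Defensive.
Local Open Scope sesquilinear_scope.

(** * Frobenius norms and positive quadratic forms *)

Section Frobenius.
Variable C : numClosedFieldType.

Lemma adjmxM m n k (A : 'M[C]_(m, n)) (B : 'M_(n, k)) :
  (A *m B) ^t* = B ^t* *m A ^t*.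
Proof. by rewrite trmx_mul map_mxM. Qed.

Lemma adjmx_tens m n k l (A : 'M[C]_(m, n)) (B : 'M_(k, l)) :
  (A *t B) ^t* = A ^t* *t B ^t*.
Proof. by rewrite trmx_tens map_mxT. Qed.

Definition frob m n (A : 'M[C]_(m, n)) : C := \tr (A *m A ^t*).

Lemma frobE m n (A : 'M[C]_(m, n)) : frob A = \sum_i \sum_j `|A i j| ^+ 2.
Proof.
apply: eq_bigr => i _; rewrite mxE; apply: eq_bigr => j _.
by rewrite !mxE normCK.
Qed.

Lemma frob_ge0 m n (A : 'M[C]_(m, n)) : 0 <= frob A.
Proof.
by rewrite frobE; do 2![apply: sumr_ge0 => ? _]; rewrite exprn_ge0.
Qed.

Lemma frob_tr m n (A : 'M[C]_(m, n)) : frob A^T = frob A.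
Proof.
rewrite !frobE exchange_big /=.
by apply: eq_bigr => i _; apply: eq_bigr => j _; rewrite mxE.
Qed.

Lemma frob_adj m n (A : 'M[C]_(m, n)) : frob (A ^t*) = frob A.
Proof. by rewrite /frob trmxCK mxtrace_mulC. Qed.

Lemma frob1 n : frob (1%:M : 'M[C]_n) = n%:R.
Proof. by rewrite /frob mul1mx trmx1 map_mx1 mxtrace1. Qed.

(** Each entry of [A *m B] is the inner product of a row of [A] with a row of [B ^t*], so
    Cauchy-Schwarz bounds its square; the sum over all entries factors. *)
Lemma frobM_le m n k (A : 'M[C]_(m, n)) (B : 'M_(n, k)) :
  frob (A *m B) <= frob A * frob B.
Proof.
rewrite -(frob_adj B) !frobE mulr_suml ler_sum // => i _.
rewrite mulr_sumr ler_sum // => j _.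
have -> : (A *m B) i j = (row i A *m (row j (B ^t*)) ^t*) 0 0.
  by rewrite !mxE; apply: eq_bigr => l _; rewrite !mxE conjCK.
have norm2 (p : nat) (u : 'rV[C]_p) : (u *m u ^t*) 0 0 = \sum_l `|u 0 l| ^+ 2.
  by rewrite mxE; apply: eq_bigr => l _; rewrite !mxE normCK.
have := (CauchySchwarz (@dotmx C n) (row i A) (row j (B ^t*))).1.
rewrite -[X in `|X|]/(dotmx _ _) -[X in X * _]/(dotmx _ _)
  -[X in _ * X]/(dotmx _ _).
rewrite !dotmxE !norm2 => /le_trans; apply.
rewrite le_eqVlt; apply/orP; left; apply/eqP.
by congr (_ * _); apply: eq_bigr => l _; rewrite !mxE.
Qed.

Lemma big_mxtens (T : nmodType) m n (F : 'I_(m * n) -> T) :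
  \sum_k F k = \sum_i \sum_j F (mxtens_index (i, j)).
Proof.
rewrite pair_bigA /= (reindex (@mxtens_index m n)) /=.
  by apply: eq_bigr => -[i j].
by exists (@mxtens_unindex m n) => ? _;
  rewrite (mxtens_indexK, mxtens_unindexK).
Qed.

Lemma tensmx11 m n : 1%:M *t 1%:M = 1%:M :> 'M[C]_(m * n).
Proof.
apply/matrixP => k l; case: (mxtens_indexP k) => i j.
case: (mxtens_indexP l) => i' j'.
by rewrite tensmxE !mxE (can_eq (@mxtens_indexK m n)) xpair_eqE -natrM mulnb.
Qed.

Lemma frob_tens m n k l (A : 'M[C]_(m, n)) (B : 'M_(k, l)) :
  frob (A *t B) = frob A * frob B.
Proof.
rewrite !frobE big_mxtens mulr_suml; apply: eq_bigr => i _.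
rewrite mulr_sumr; apply: eq_bigr => j _.
rewrite big_mxtens mulr_suml; apply: eq_bigr => i' _.
rewrite mulr_sumr; apply: eq_bigr => j' _.
by rewrite tensmxE normrM exprMn.
Qed.

(** The condition [\sum A^* A <= 1], tested on matrices [v] of any width because it is applied to
    operator products, to transposes and to the identity. *)
Definition subunital m n (As : seq 'M[C]_(m, n)) :=
  forall k (v : 'M[C]_(n, k)), \sum_(A <- As) frob (A *m v) <= frob v.

(** The positivity clause of [psdmx]; [0 <=] in [C] also says that the form is real. *)
Definition posmx n (A : 'M[C]_n) :=
  forall v : 'cV[C]_n, 0 <= (v ^t* *m A *m v) 0 0.

Lemma posmx_conj m n (A : 'M[C]_n) (B : 'M_(m, n)) :
  posmx A -> posmx (B *m A *m B ^t*).
Proof.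
move=> pA v; have := pA (B ^t* *m v).
by rewrite adjmxM trmxCK !mulmxA.
Qed.

Lemma posmx_sum n (I : Type) (r : seq I) (F : I -> 'M[C]_n) :
  (forall i, posmx (F i)) -> posmx (\sum_(i <- r) F i).
Proof.
move=> pF v; rewrite mulmx_sumr mulmx_suml summxE.
by apply: sumr_ge0 => i _; apply: pF.
Qed.

Lemma posmx_tr n (A : 'M[C]_n) : posmx A -> 0 <= \tr A.
Proof.
move=> pA; apply: sumr_ge0 => i _; have := pA (delta_mx i 0).
rewrite trmx_delta map_delta_mx -rowE !mxE (bigD1 i) //= big1 => [|j ji].
  by rewrite !mxE !eqxx mulr1 addr0.
by rewrite !mxE (negPf ji) mulr0.
Qed.

(* [\tr A - e^* A e = \tr (Q A Q^* )] for the projection [Q := 1 - e e^*]. *)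
Lemma posmx_qform_le_tr n (A : 'M[C]_n) (e : 'cV[C]_n) :
  posmx A -> e ^t* *m e = 1%:M -> (e ^t* *m A *m e) 0 0 <= \tr A.
Proof.
move=> pA e1; have := posmx_tr (posmx_conj (1%:M - e *m e ^t*) pA).
set Q := 1%:M - _.
have QA : Q ^t* = Q.
  by rewrite /Q linearB /= trmx1 map_mxB map_mx1 adjmxM trmxCK.
have QQ : Q *m Q = Q.
  rewrite {1}/Q mulmxBl mul1mx /Q mulmxBr mulmx1 mulmxA -(mulmxA e) e1 mulmx1.
  by rewrite subrr subr0.
rewrite QA mxtrace_mulC mulmxA QQ /Q mulmxBl mul1mx linearB /= subr_ge0.
by rewrite -!mulmxA mxtrace_mulC trace_mx11 mulmxA.
Qed.

Lemma posmx_gram m n (A : 'M[C]_(m, n)) : posmx (A *m A ^t*).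
Proof.
move=> v; rewrite -trace_mx11 -!mulmxA mulmxA.
by have := frob_ge0 (v ^t* *m A); rewrite /frob adjmxM trmxCK.
Qed.

End Frobenius.

(** * Amplitudes of EPR pairs and the transpose identity *)

Section EPR.
Variable R : realType.
Local Notation C := R[i].

(** Induction on [m]: a number is its lowest bit plus twice its half, and the bits of the half are
    the remaining bits. *)
Lemma bit_inj m (x y : 'I_(2 ^ m)) :
  (forall i : 'I_m, bit x i = bit y i) -> x = y.
Proof.
move=> H; apply: val_inj => /=.
have {}H i : (i < m)%N -> odd (x %/ 2 ^ i) = odd (y %/ 2 ^ i).
  move=> im; have /(congr1 val) := H (Ordinal im).
  by rewrite /bit /= !inordK ?ltnS ?leq_b1 //; do 2 case: odd.
have: (x < 2 ^ m)%N /\ (y < 2 ^ m)%N by [].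
move: (x : nat) (y : nat) H => {x y}.
elim: m => [|m IH] x y H [].
  by rewrite expn0 !ltnS !leqn0 => /eqP-> /eqP->.
move=> xm ym; rewrite -(odd_double_half x) -(odd_double_half y).
have /= := H 0%N isT; rewrite !divn1 => ->.
congr (_ + _.*2)%N; apply: IH => [i im|].
  by have := H i.+1 im; rewrite expnS !divnMA !divn2.
by rewrite -!divn2 !ltn_divLR // -expnSr.
Qed.

(** A factor [PhiPlus] vanishes unless its two bits agree, so the product survives only if all bits
    agree, which by [bit_inj] means [x = y]. *)
Lemma EPRE m (x y : 'I_(2 ^ m)) :
  EPR R m (mxtens_index (x, y)) 0 = (sqrtC 2) ^- m * (x == y)%:R.
Proof.
rewrite mxE mxtens_indexK /=.
have E i : PhiPlus R (mxtens_index (bit x i, bit y i)) 0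
    = (sqrtC 2)^-1 * (bit x i == bit y i)%:R.
  rewrite mxE; congr (_ * _); rewrite mxE.
  (* The column index must itself be a tensor index before [tensmxE] applies. *)
  have -> : (0 : 'I_1) = mxtens_index (0 : 'I_1, 0 : 'I_1) by apply: val_inj.
  rewrite !tensmxE !mxE.
  by case: (bit x i) (bit y i) => [[|[|//]] ?] [[|[|//]] ?];
    rewrite /= ?(mulr1, mulr0, addr0, add0r).
under eq_bigr do rewrite E.
rewrite big_split prodr_const card_ord exprVn; congr (_ * _).
have [->|xy] := eqVneq x y; first by rewrite big1 // => i _; rewrite eqxx.
have [i bi] : exists i : 'I_m, bit x i != bit y i.
  apply/existsP; apply: contraR xy; rewrite negb_exists => /forallP H.
  by apply/eqP/bit_inj => i; apply/eqP; have := H i; rewrite negbK.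
by rewrite (bigD1 i) //= (negPf bi) mul0r.
Qed.

(** Reshaped into a matrix, the vector [(A *t B) *m EPR R n] is [A *m B^T] divided by
    [sqrtC 2 ^+ n]. *)
Lemma frob_tens_EPR m n k (A : 'M[C]_(k, 2 ^ n)) (B : 'M[C]_(m, 2 ^ n)) :
  frob ((A *t B) *m EPR R n) = (2 ^ n)%:R^-1 * frob (A *m B^T).
Proof.
rewrite !frobE big_mxtens mulr_sumr; apply: eq_bigr => i _.
rewrite mulr_sumr; apply: eq_bigr => j _.
rewrite big_ord1.
have -> : ((A *t B) *m EPR R n) (mxtens_index (i, j)) 0
    = (sqrtC 2) ^- n * (A *m B^T) i j.
  rewrite !mxE big_mxtens mulr_sumr; apply: eq_bigr => l _.
  rewrite (bigD1 l) //= big1 ?addr0 => [|l' ll'].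
    by rewrite tensmxE EPRE eqxx mulr1 mxE mulrC.
  by rewrite EPRE eq_sym (negPf ll') !mulr0.
rewrite normrM exprMn normfV normrX ger0_norm ?sqrtC_ge0 ?ler0n //.
by rewrite exprVn -exprM mulnC exprM sqrtCK natrX.
Qed.

Lemma frob_EPR m : frob (EPR R m) = 1.
Proof.
rewrite -[EPR R m]mul1mx -tensmx11 frob_tens_EPR trmx1 mul1mx frob1 mulVf //.
by rewrite pnatr_eq0 -lt0n expn_gt0.
Qed.

Lemma EPR_unit m : (EPR R m) ^t* *m EPR R m = 1%:M.
Proof.
by rewrite [LHS]mx11_scalar -trace_mx11 mxtrace_mulC -/(frob _) frob_EPR.
Qed.

End EPR.

(** * Sums of product maps indexed by transcripts *)

Section LocalOperations.
Variable C : numClosedFieldType.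

Definition comp_kraus m n k (As : seq 'M[C]_(m, n)) (Ks : seq 'M[C]_(n, k)) :=
  [seq A *m K | K <- Ks, A <- As].

Lemma subunital_comp m n k (As : seq 'M[C]_(m, n)) (Ks : seq 'M[C]_(n, k)) :
  subunital As -> subunital Ks -> subunital (comp_kraus As Ks).
Proof.
move=> sA sK l v; rewrite big_allpairs_dep /=; apply: le_trans (sK l v).
apply: ler_sum => K _; apply: le_trans (sA l (K *m v)).
by under eq_bigr do rewrite -mulmxA.
Qed.

Lemma subunital_isometry m n (V : 'M[C]_(m, n)) :
  V ^t* *m V = 1%:M -> subunital [:: V].
Proof.
move=> V1 k v; rewrite big_seq1 /frob adjmxM mxtrace_mulC.
by rewrite -mulmxA (mulmxA _ V) V1 mul1mx mxtrace_mulC.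
Qed.

(** A completely positive map with product Kraus operators, grouped by transcript so that
    transcripts can be counted. *)
Definition local_map k d l e (ts : seq (seq 'M[C]_(k, d) * seq 'M[C]_(l, e)))
    (sigma : 'M[C]_(d * e)) : 'M[C]_(k * l) :=
  \sum_(t <- ts) \sum_(A <- t.1) \sum_(B <- t.2)
     (A *t B) *m sigma *m (A *t B) ^t*.

Lemma local_mapD k d l e (ts : seq (seq 'M[C]_(k, d) * seq 'M[C]_(l, e))) x y :
  local_map ts (x + y) = local_map ts x + local_map ts y.
Proof.
rewrite -big_split /=; apply: eq_bigr => t _.
rewrite -big_split /=; apply: eq_bigr => A _.
rewrite -big_split /=; apply: eq_bigr => B _.
by rewrite mulmxDr mulmxDl.
Qed.

Lemma local_mapZ k d l e (ts : seq (seq 'M[C]_(k, d) * seq 'M[C]_(l, e))) a x :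
  local_map ts (a *: x) = a *: local_map ts x.
Proof.
rewrite scaler_sumr; apply: eq_bigr => t _.
rewrite scaler_sumr; apply: eq_bigr => A _.
rewrite scaler_sumr; apply: eq_bigr => B _.
by rewrite -scalemxAr -scalemxAl.
Qed.

(** Rests on [(A K) *t (B L) = (A *t B) (K *t L)]. Precomposition acts within each pair of the list,
    so no transcript is added. *)
Lemma local_map_comp k d l e d' e'
    (ts : seq (seq 'M[C]_(k, d) * seq 'M[C]_(l, e)))
    (Ks : seq 'M[C]_(d, d')) (Ls : seq 'M[C]_(e, e')) sigma :
  local_map [seq (comp_kraus t.1 Ks, comp_kraus t.2 Ls) | t <- ts] sigma
  = local_map ts (local_map [:: (Ks, Ls)] sigma).
Proof.
rewrite /local_map big_map big_seq1 /=; apply: eq_bigr => t _.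
rewrite big_allpairs_dep /= exchange_big /=; apply: eq_bigr => A _.
under eq_bigr do rewrite big_allpairs_dep /= exchange_big /=.
rewrite exchange_big /=; apply: eq_bigr => B _.
rewrite mulmx_sumr mulmx_suml; apply: eq_bigr => K _.
rewrite mulmx_sumr mulmx_suml; apply: eq_bigr => L _.
by rewrite -tensmx_mul adjmxM !mulmxA.
Qed.

Lemma local_map_posmx k d l e
    (ts : seq (seq 'M[C]_(k, d) * seq 'M[C]_(l, e))) x :
  posmx x -> posmx (local_map ts x).
Proof.
move=> px; apply: posmx_sum => t; apply: posmx_sum => A; apply: posmx_sum => B.
exact: posmx_conj.
Qed.

(* The pairs in the list stand for the transcripts of the communication; the
   two components are the Kraus operators of Alice and of Bob. *)
Definition local_family k d l e s
    (ts : seq (seq 'M[C]_(k, d) * seq 'M[C]_(l, e))) :=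
  size ts = (2 ^ s)%N /\ {in ts, forall t, subunital t.1 /\ subunital t.2}.

Lemma local_family_comp k d l e d' e' s
    (ts : seq (seq 'M[C]_(k, d) * seq 'M[C]_(l, e)))
    (Ks : seq 'M[C]_(d, d')) (Ls : seq 'M[C]_(e, e')) :
  subunital Ks -> subunital Ls -> local_family s ts ->
  local_family s [seq (comp_kraus t.1 Ks, comp_kraus t.2 Ls) | t <- ts].
Proof.
move=> sK sL [sz sts]; split; first by rewrite size_map.
move=> _ /mapP[t /sts[sA sB] ->] /=.
by split; apply: subunital_comp.
Qed.

(** One round: the bit sent selects a branch, and concatenating the two lists doubles the count. In
    use, the party that does not act contributes the identity. *)
Lemma local_family_branch k d l e d' e' s
    (ts : bool -> seq (seq 'M[C]_(k, d) * seq 'M[C]_(l, e)))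
    (Ks : bool -> seq 'M[C]_(d, d')) (Ls : bool -> seq 'M[C]_(e, e')) :
  (forall c, local_family s (ts c)) ->
  (forall c, subunital (Ks c)) -> (forall c, subunital (Ls c)) ->
  exists2 us, local_family s.+1 us & forall sigma,
    local_map us sigma =
    \sum_c local_map (ts c) (local_map [:: (Ks c, Ls c)] sigma).
Proof.
move=> fts sK sL.
pose us c := [seq (comp_kraus t.1 (Ks c), comp_kraus t.2 (Ls c)) | t <- ts c].
have fus c : local_family s (us c) by apply: local_family_comp.
exists (us true ++ us false) => [|sigma].
  have [[zt st] [zf sf]] := (fus true, fus false).
  split; first by rewrite size_cat zt zf addnn -mul2n expnS.
  by move=> t; rewrite mem_cat => /orP[/st|/sf].
by rewrite {1}/local_map big_cat big_bool -!local_map_comp.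
Qed.

End LocalOperations.

(** * Deterministic protocols as sums over [2 ^ s] transcripts *)

Section Protocols.
Variable R : realType.
Local Notation C := R[i].

(** By completeness the norms over all outcomes add up to [frob v]; keeping one outcome drops
    nonnegative terms. *)
Lemma subunital_kraus (O : finType) d d' (K : instrument R O d d') o :
  subunital (codom (kraus K o)).
Proof.
move=> k v; rewrite big_image /=.
have E : frob v = \sum_o' \sum_j frob (kraus K o' j *m v).
  have -> : frob v = \tr (v ^t* *m 1%:M *m v) by rewrite mulmx1 mxtrace_mulC.
  rewrite -(kraus_complete K) mulmx_sumr mulmx_suml linear_sum.
  apply: eq_bigr => o' _; rewrite mulmx_sumr mulmx_suml linear_sum.
  apply: eq_bigr => j _.
  by rewrite /frob adjmxM [RHS]mxtrace_mulC !mulmxA.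
rewrite E (bigD1 o) //= lerDl; do 2![apply: sumr_ge0 => ? _].
exact: frob_ge0.
Qed.

Lemma subunital1 d : subunital [:: 1%:M : 'M[C]_d].
Proof. by apply: subunital_isometry; rewrite mulmx1 trmx1 map_mx1. Qed.

Lemma apply_AliceE (O : finType) d d' e (K : instrument R O d d') o
    (sigma : 'M[C]_(d * e)) :
  apply_Alice K o sigma = local_map [:: (codom (kraus K o), [:: 1%:M])] sigma.
Proof.
rewrite /local_map big_seq1 /= big_image.
by apply: eq_bigr => j _; rewrite big_seq1.
Qed.

Lemma apply_BobE (O : finType) d e e' (K : instrument R O e e') o
    (sigma : 'M[C]_(d * e)) :
  apply_Bob K o sigma = local_map [:: ([:: 1%:M], codom (kraus K o))] sigma.
Proof. by rewrite /local_map !big_seq1 /= big_image. Qed.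

Lemma run_local_map dA dB m s (P : rounds R dA dB m s) r :
  exists2 ts, local_family s ts &
    forall sigma, run P r sigma = local_map ts sigma.
Proof.
elim: s / P => [K L|s K next IH|s K next IH].
(* With [r] fixed the final operations form a single transcript, matching [2 ^ 0]. Alice's operation
   acts first, as in [run]. *)
- exists [seq (comp_kraus t.1 (codom (kraus K r)), comp_kraus t.2 [:: 1%:M])
         | t <- [:: ([:: 1%:M], codom (kraus L tt))]].
    apply: local_family_comp (subunital_kraus _ _) (@subunital1 _) _.
    split=> // t; rewrite inE => /eqP-> /=.
    by split; [apply: subunital1|apply: subunital_kraus].
  by move=> sigma; rewrite local_map_comp /= apply_BobE apply_AliceE.
- have /choice[ts fts] c : exists ts, local_family s ts /\
      forall sigma, run (next c) r sigma = local_map ts sigma.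
    by have [ts ? ?] := IH c; exists ts.
  have [us fus eus] := local_family_branch (fun c => (fts c).1)
    (fun c => subunital_kraus K c) (fun=> @subunital1 dB).
  exists us => // sigma; rewrite eus /=.
  by apply: eq_bigr => c _; rewrite (fts c).2 apply_AliceE.
- have /choice[ts fts] c : exists ts, local_family s ts /\
      forall sigma, run (next c) r sigma = local_map ts sigma.
    by have [ts ? ?] := IH c; exists ts.
  have [us fus eus] := local_family_branch (fun c => (fts c).1)
    (fun=> @subunital1 dA) (fun c => subunital_kraus K c).
  exists us => // sigma; rewrite eus /=.
  by apply: eq_bigr => c _; rewrite (fts c).2 apply_BobE.
Qed.

Lemma add_ancilla_isometry n a :
  (add_ancilla R n a) ^t* *m add_ancilla R n a = 1%:M.
Proof.
have a0 : (0 < 2 ^ a)%N by rewrite expn_gt0.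
apply/matrixP => i j; rewrite !mxE big_mxtens (bigD1 i) //=.
rewrite [X in _ + X]big1 ?addr0 => [|k ki]; last first.
  apply: big1 => l _; rewrite !mxE mxtens_indexK /= (negPf ki).
  by rewrite conjC0 mul0r.
rewrite (bigD1 (Ordinal a0)) //= big1 ?addr0 => [|l l0]; last first.
  rewrite !mxE mxtens_indexK /= -(inj_eq val_inj) /= in l0 *.
  by rewrite (negPf l0) !andbF mulr0.
by rewrite !mxE mxtens_indexK /= eqxx conjC1 mul1r andbT.
Qed.

(** Adjoining ancillas is a local isometry, absorbed into each Kraus list. The operators then act on
    dimension [2 ^ n], so the later bounds do not depend on the number of ancillas. *)
Lemma det_protocol_local_map n m s (D : det_protocol R n m s) r :
  exists2 ts, local_family s ts & forall rho,
    run (det_rounds D) r (init_state (ancA D) (ancB D) rho) = local_map ts rho.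
Proof.
have [ts f e] := run_local_map (det_rounds D) r.
exists [seq (comp_kraus t.1 [:: add_ancilla R n (ancA D)],
             comp_kraus t.2 [:: add_ancilla R n (ancB D)]) | t <- ts].
  by apply: local_family_comp f; apply/subunital_isometry/add_ancilla_isometry.
move=> rho; rewrite local_map_comp e.
by congr local_map; rewrite /local_map !big_seq1.
Qed.

End Protocols.

(* Locked, because unification would otherwise unfold the scalar in [R[i]]. *)
Definition max_mixed (R : realType) d : 'M[R[i]]_(d * d) :=
  locked (d%:R ^- 2)%:M.

Lemma max_mixedE (R : realType) d : max_mixed R d = (d%:R ^- 2)%:M.
Proof. by rewrite /max_mixed -lock. Qed.

Lemma max_mixed_posmx (R : realType) d : posmx (max_mixed R d).
Proof.
move=> v; rewrite max_mixedE -scalemx1 -scalemxAr -scalemxAl mxE mulmx1.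
rewrite mulr_ge0 ?invr_ge0 ?exprn_ge0 ?ler0n //.
by have := frob_ge0 (v ^t*); rewrite /frob trmxCK trace_mx11.
Qed.

Lemma max_mixed_adj (R : realType) d : (max_mixed R d) ^t* = max_mixed R d.
Proof.
rewrite max_mixedE tr_scalar_mx map_scalar_mx; congr (_%:M).
by rewrite /= conj_Creal // rpredV rpredX // realn.
Qed.

Lemma tr_max_mixed (R : realType) d : (0 < d)%N -> \tr (max_mixed R d) = 1.
Proof.
move=> d0; rewrite max_mixedE mxtrace_scalar -(mulr_natr _ (d * d)) natrM.
by rewrite -expr2 mulVf // expf_neq0 // pnatr_eq0 -lt0n.
Qed.

(** * Weights of one transcript on the ideal and on the maximally mixed state *)

Section Bounds.
Variable R : realType.
Local Notation C := R[i].
Variables n m s : nat.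
Local Notation N := ((2 ^ n)%:R : C).
Local Notation kraus_seq := (seq 'M[C]_(2 ^ m, 2 ^ n)).

Let N_gt0 : 0 < N.
Proof. by rewrite ltr0n expn_gt0. Qed.

Let Ninv_ge0 : 0 <= N^-1.
Proof. by rewrite invr_ge0 ler0n. Qed.

(** The probability of the transcript on [EPR_density R n], as [tr_local_map_EPR] shows, in the form
    given by [frob_tens_EPR]. *)
Definition ideal_weight (t : kraus_seq * kraus_seq) : C :=
  N^-1 * \sum_(A <- t.1) \sum_(B <- t.2) frob (A *m B^T).

(** The same probability on the maximally mixed state; it factors because that state is a
    product. *)
Definition mixed_weight (t : kraus_seq * kraus_seq) : C :=
  N^-2 * \sum_(A <- t.1) \sum_(B <- t.2) frob A * frob B.

Lemma ideal_weight_ge0 t : 0 <= ideal_weight t.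
Proof.
apply: mulr_ge0 => //.
by do 2![apply: sumr_ge0 => ? _]; apply: frob_ge0.
Qed.

(** For fixed [A], [frob (A *m B^T) = frob (B *m A^T)], and Bob's operators together do not increase
    the norm of [A^T]. *)
Lemma ideal_weight_le t : subunital t.1 -> subunital t.2 ->
  ideal_weight t <= N^-1 * (\sum_(A <- t.1) frob A).
Proof.
move=> sA sB; rewrite ler_wpM2l // ler_sum // => A _.
rewrite -(frob_tr A); apply: le_trans (sB _ A^T).
by apply: ler_sum => B _; rewrite -(frob_tr (A *m _)) trmx_mul trmxK.
Qed.

(** Lets the bound by Alice's operators be reused as one by Bob's. *)
Lemma ideal_weight_swap t : ideal_weight t = ideal_weight (t.2, t.1).
Proof.
congr (_ * _); rewrite [LHS]exchange_big.
apply: eq_bigr => B _; apply: eq_bigr => A _.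
by rewrite -frob_tr trmx_mul trmxK.
Qed.

Lemma ideal_weight_le1 t :
  subunital t.1 -> subunital t.2 -> ideal_weight t <= 1.
Proof.
move=> sA sB; apply: le_trans (ideal_weight_le sA sB) _.
rewrite ler_pdivrMl // mulr1 -frob1; apply: le_trans (sA _ 1%:M).
by under [leRHS]eq_bigr do rewrite mulmx1.
Qed.

(** The product of the two one-sided bounds is exactly [mixed_weight t]. *)
Lemma ideal_weight_sqr_le t : subunital t.1 -> subunital t.2 ->
  ideal_weight t ^+ 2 <= mixed_weight t.
Proof.
move=> sA sB; have wA := ideal_weight_le sA sB.
have wB : ideal_weight t <= N^-1 * (\sum_(B <- t.2) frob B).
  by rewrite ideal_weight_swap ideal_weight_le.
rewrite expr2; apply: le_trans (ler_pM _ _ wA wB) _;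
  rewrite ?ideal_weight_ge0 //.
rewrite mulrACA -invfM -expr2 /mixed_weight mulr_suml.
by under [in leRHS]eq_bigr do rewrite -mulr_sumr.
Qed.

Lemma tr_local_map_EPR (ts : seq (kraus_seq * kraus_seq)) :
  \tr (local_map ts (EPR_density R n)) = \sum_(t <- ts) ideal_weight t.
Proof.
rewrite linear_sum; apply: eq_bigr => t _.
rewrite /ideal_weight linear_sum mulr_sumr; apply: eq_bigr => A _.
rewrite linear_sum mulr_sumr; apply: eq_bigr => B _.
by rewrite -frob_tens_EPR /frob adjmxM !mulmxA.
Qed.

Lemma tr_local_map_mixed (ts : seq (kraus_seq * kraus_seq)) :
  \tr (local_map ts (max_mixed R (2 ^ n))) = \sum_(t <- ts) mixed_weight t.
Proof.
rewrite max_mixedE -scalemx1 local_mapZ mxtraceZ linear_sum mulr_sumr.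
apply: eq_bigr => t _.
rewrite linear_sum; congr (_ * _); apply: eq_bigr => A _.
rewrite linear_sum; apply: eq_bigr => B _.
by rewrite mulmx1 -frob_tens.
Qed.

(* The fidelity of a separable state with m EPR pairs is at most 2^-m. *)
Lemma qform_local_map_mixed (ts : seq (kraus_seq * kraus_seq)) :
  (0 < m)%N ->
  ((EPR R m) ^t* *m local_map ts (max_mixed R (2 ^ n)) *m EPR R m) 0 0
  <= \tr (local_map ts (max_mixed R (2 ^ n))) / 2.
Proof.
move=> m_gt0; rewrite tr_local_map_mixed -trace_mx11.
rewrite max_mixedE -scalemx1 local_mapZ -scalemxAr -scalemxAl mxtraceZ.
rewrite /mixed_weight -mulr_sumr -mulrA.
rewrite ler_wpM2l ?invr_ge0 ?exprn_ge0 ?ler0n //.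
rewrite mulmx_sumr mulmx_suml linear_sum mulr_suml ler_sum // => t _.
rewrite mulmx_sumr mulmx_suml linear_sum mulr_suml ler_sum // => A _.
rewrite mulmx_sumr mulmx_suml linear_sum mulr_suml ler_sum // => B _.
rewrite mulmx1 !mulmxA /=.
(* With [M := A *t B] and [e] the EPR vector, [e^* M M^* e] is the squared norm of [M^* e], so the
   transpose identity applies to the adjoints. *)
have -> : \tr ((EPR R m) ^t* *m (A *t B) *m (A *t B) ^t* *m EPR R m)
    = frob ((A ^t* *t B ^t*) *m EPR R m).
  by rewrite /frob -adjmx_tens adjmxM trmxCK [RHS]mxtrace_mulC !mulmxA.
rewrite frob_tens_EPR mulrC ler_pM ?frob_ge0 ?invr_ge0 ?ler0n //.
  by rewrite (le_trans (frobM_le _ _)) // frob_tr !frob_adj.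
(* Here [m >= 1] enters, through [2 ^ 1 <= 2 ^ m]. *)
by rewrite lef_pV2 ?posrE ?ltr0n ?expn_gt0 // ler_nat -{1}[2%N]expn1 leq_exp2l.
Qed.

End Bounds.

(** * Scalar inequalities *)

(** Nonnegativity of a variance: expand the weighted sum of squared deviations of [f] from its
    mean. *)
Lemma mean_square_le (C : numClosedFieldType) (W : finType) (T : Type)
    (r : W -> C) (ts : W -> seq T) (f : W -> T -> C) (D : nat) :
  (0 < D)%N -> (forall w, 0 <= r w) -> \sum_w r w = 1 ->
  (forall w, size (ts w) = D) -> (forall w t, 0 <= f w t) ->
  (\sum_w r w * \sum_(t <- ts w) f w t) ^+ 2
  <= D%:R * \sum_w r w * \sum_(t <- ts w) f w t ^+ 2.
Proof.
move=> D_gt0 r0 r1 szD f0; set p := \sum_w _.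
have D0 : (0 : C) < D%:R by rewrite ltr0n.
have p0 : 0 <= p.
  by apply: sumr_ge0 => w _; rewrite mulr_ge0 // sumr_ge0.
(* The mean of [f] over pairs [(w, t)] of weight [r w], whose total weight is [D]. *)
pose x := p / D%:R.
have x0 : 0 <= x by rewrite divr_ge0 // ltW.
have : 0 <= \sum_w r w * \sum_(t <- ts w) (f w t - x) ^+ 2.
  apply: sumr_ge0 => w _; rewrite mulr_ge0 // sumr_ge0 // => t _.
  by rewrite real_exprn_even_ge0 // rpredB ?ger0_real.
have -> : \sum_w r w * \sum_(t <- ts w) (f w t - x) ^+ 2
    = \sum_w r w * (\sum_(t <- ts w) f w t ^+ 2)
      - 2 * x * p + x ^+ 2 * D%:R * \sum_w r w.
  rewrite /p !mulr_sumr -sumrB -big_split /=; apply: eq_bigr => w _.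
  under eq_bigr do rewrite sqrrB.
  rewrite big_split sumrB /= big_const_seq count_predT iter_addr_0 szD.
  rewrite -(mulr_natl (x ^+ 2)).
  under [X in _ - X]eq_bigr do rewrite -mulrnAl -mulr_natl mulrAC.
  rewrite -mulr_sumr; ring.
rewrite r1 mulr1 => h; rewrite -subr_ge0.
have -> : D%:R * (\sum_w r w * \sum_(t <- ts w) f w t ^+ 2) - p ^+ 2
  = D%:R * (\sum_w r w * (\sum_(t <- ts w) f w t ^+ 2)
      - 2 * x * p + x ^+ 2 * D%:R).
  by rewrite /x; field; rewrite gt_eqF.
by rewrite mulr_ge0 // ltW.
Qed.

Lemma mixture_gt0 (R : realFieldType) (e p q : R) :
  0 <= e <= 1 -> 0 < p -> 0 < q -> 0 < (1 - e) * p + e * q.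
Proof.
(* At [e = 0] positivity comes from [p]; otherwise from [e * q], as the first term may vanish at
   [e = 1]. *)
move=> /andP[e0 e1] p0 q0; have [->|e_neq0] := eqVneq e 0; first by lra.
rewrite ltr_wpDl ?mulr_ge0 ?subr_ge0 // ?(ltW p0) // mulr_gt0 //.
by rewrite lt_def e_neq0.
Qed.

(* [p] and [q] are the success probabilities on the ideal and on the maximally
   mixed state, [f] and [g] the corresponding unnormalized fidelities. *)
Lemma mixture_bound (R : realFieldType) (e p q f g D : R) :
  0 <= e <= 1 -> 0 < p -> p <= D -> p ^+ 2 <= D * q -> f <= p -> g <= q / 2 ->
  ((1 - e) * f + e * g) / ((1 - e) * p + e * q) <= 1 - e * p / (2 * D).
Proof.
move=> he p0 pD pq fp gq.
have D0 : 0 < D by lra.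
have q0 : 0 < q.
  by rewrite -(pmulr_rgt0 _ D0); apply: lt_le_trans pq; rewrite exprn_gt0.
have s0 := mixture_gt0 he p0 q0; case/andP: he => e0 e1.
rewrite ler_pdivrMr //.
have h1 : (1 - e) * f <= (1 - e) * p by rewrite ler_wpM2l // subr_ge0.
have h2 : e * g <= e * (q / 2) by rewrite ler_wpM2l.
apply: le_trans (lerD h1 h2) _.
(* The numerator is at most the denominator minus [e * q / 2], so it remains to bound [q] below by
   [p / D] times the denominator. Its two terms use [p ^+ 2 <= D * q] and [p <= D] respectively. *)
have h3 : p / D * ((1 - e) * p + e * q) <= q.
  rewrite mulrAC ler_pdivrMr //.
  have : (1 - e) * p ^+ 2 <= (1 - e) * (D * q) by rewrite ler_wpM2l // subr_ge0.
  have : p * (e * q) <= D * (e * q) by rewrite ler_wpM2r // mulr_ge0 // ltW.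
  rewrite expr2; lra.
have h4 : e * (p / D * ((1 - e) * p + e * q)) <= e * q by rewrite ler_wpM2l.
have -> : e * p / (2 * D) = e * (p / D) / 2 by field; rewrite gt_eqF.
lra.
Qed.

(** * Probabilistic protocols and the adversarial state *)

Section Main.
Variable R : realType.
Local Notation C := R[i].
Local Open Scope complex_scope.

Let ReD (x y : C) : complex.Re (x + y) = complex.Re x + complex.Re y.
Proof. by case: x y => [? ?] []. Qed.

Let ReZ (a : R) (x : C) : complex.Re (a%:C * x) = a * complex.Re x.
Proof. by case: x => u v /=; rewrite mul0r subr0. Qed.

(** Positivity makes the form real, so taking [complex.Re] loses nothing and inequalities can be
    proved in [C]. *)
Lemma fidelityE m (sigma : 'M[C]_(2 ^ m * 2 ^ m)) : posmx sigma ->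
  (fidelity sigma)%:C = ((EPR R m) ^t* *m sigma *m EPR R m) 0 0.
Proof. by move=> ps; rewrite RRe_real // ger0_real // ps. Qed.

Lemma fidelityD m (x y : 'M[C]_(2 ^ m * 2 ^ m)) :
  fidelity (x + y) = fidelity x + fidelity y.
Proof. by rewrite /fidelity mulmxDr mulmxDl mxE ReD. Qed.

Lemma fidelityZ m (a : R) (x : 'M[C]_(2 ^ m * 2 ^ m)) :
  fidelity (a%:C *: x) = a * fidelity x.
Proof. by rewrite /fidelity -scalemxAr -scalemxAl mxE ReZ. Qed.

Lemma fidelity_EPR n : fidelity (EPR_density R n) = 1.
Proof.
by rewrite /fidelity /EPR_density mulmxA EPR_unit mul1mx EPR_unit mxE.
Qed.

Variables n m s : nat.
Variable P : prob_protocol R n m s.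
Local Notation S := (success_state P).
Local Notation mixed := (max_mixed R (2 ^ n)).

Lemma success_state_local_map : exists2 ts : rand_string P -> _,
  forall w, local_family s (ts w) &
  forall rho, S rho = \sum_w (rand_prob P w)%:C *: local_map (ts w) rho.
Proof.
have /choice[ts fts] w : exists ts, local_family s ts /\ forall rho,
    run (det_rounds (protocol_at P w)) true
      (init_state (ancA (protocol_at P w)) (ancB (protocol_at P w)) rho)
    = local_map ts rho.
  by have [ts ? ?] := det_protocol_local_map (protocol_at P w) true; exists ts.
exists ts => [w|rho]; first by have [] := fts w.
by apply: eq_bigr => w _; have [_ ->] := fts w.
Qed.

Lemma success_stateD x y : S (x + y) = S x + S y.
Proof.
have [ts _ e] := success_state_local_map.
by rewrite !e -big_split; apply: eq_bigr => w _; rewrite local_mapD scalerDr.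
Qed.

Lemma success_stateZ a x : S (a *: x) = a *: S x.
Proof.
have [ts _ e] := success_state_local_map.
rewrite !e scaler_sumr; apply: eq_bigr => w _.
by rewrite local_mapZ !scalerA mulrC.
Qed.

Lemma success_probD x y :
  success_prob P (x + y) = success_prob P x + success_prob P y.
Proof. by rewrite /success_prob success_stateD mxtraceD ReD. Qed.

Lemma success_probZ (a : R) x :
  success_prob P (a%:C *: x) = a * success_prob P x.
Proof. by rewrite /success_prob success_stateZ mxtraceZ ReZ. Qed.

Lemma success_state_posmx x : posmx x -> posmx (S x).
Proof.
move=> px; have [ts _ ->] := success_state_local_map; apply: posmx_sum => w v.
rewrite -scalemxAr -scalemxAl mxE mulr_ge0 ?ler0c ?rand_prob_ge0 //.
exact: local_map_posmx.
Qed.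

Lemma success_probE x : posmx x -> (success_prob P x)%:C = \tr (S x).
Proof.
move=> px; rewrite RRe_real // ger0_real // posmx_tr //.
by apply: success_state_posmx.
Qed.

Lemma fidelity_cond_output x : posmx x ->
  fidelity (cond_output P x) = fidelity (S x) / success_prob P x.
Proof.
by move=> px; rewrite /cond_output -success_probE // -fmorphV fidelityZ mulrC.
Qed.

Lemma fidelity_ge0 (x : 'M[C]_(2 ^ m * 2 ^ m)) : posmx x -> 0 <= fidelity x.
Proof. by move=> px; rewrite -ler0c fidelityE // px. Qed.

Lemma fidelity_le_success_prob x :
  posmx x -> fidelity (S x) <= success_prob P x.
Proof.
move=> px; rewrite -lecR fidelityE ?success_probE //;
  last exact: success_state_posmx.
by apply: posmx_qform_le_tr (success_state_posmx px) (EPR_unit _ _).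
Qed.

Lemma EPR_density_posmx : posmx (EPR_density R n).
Proof. exact: posmx_gram. Qed.

Local Notation p := (ideal_success_prob P).
Local Notation q := (success_prob P mixed).

Lemma ideal_success_prob_ge0 : 0 <= p.
Proof.
rewrite -ler0c success_probE; last exact: EPR_density_posmx.
exact/posmx_tr/success_state_posmx/EPR_density_posmx.
Qed.

Lemma tr_success_state_sum ts rho :
  (forall rho, S rho = \sum_w (rand_prob P w)%:C *: local_map (ts w) rho) ->
  \tr (S rho) = \sum_w (rand_prob P w)%:C * \tr (local_map (ts w) rho).
Proof.
by move=> ->; rewrite linear_sum; apply: eq_bigr => w _; rewrite /= mxtraceZ.
Qed.

Let rand_sum1 : \sum_w (rand_prob P w)%:C = 1.
Proof. by rewrite -rmorph_sum rand_prob_sum1. Qed.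

(** A crude count, each of the [2 ^ s] transcripts weighing at most 1; it supplies [p <= D] in
    [mixture_bound]. *)
Lemma ideal_success_prob_le : p <= 2 ^+ s.
Proof.
rewrite -lecR success_probE; last exact: EPR_density_posmx.
have [ts fts e] := success_state_local_map.
rewrite (tr_success_state_sum _ e) -[leRHS]mul1r -rand_sum1 mulr_suml.
apply: ler_sum => w _; rewrite ler_wpM2l ?ler0c ?rand_prob_ge0 //.
have [sz sub] := fts w; rewrite tr_local_map_EPR.
apply: (@le_trans _ _ (\sum_(t <- ts w) 1)).
  rewrite !big_seq ler_sum // => t /sub[sA sB]; exact: ideal_weight_le1.
by rewrite big_const_seq count_predT iter_addr_0 sz natrX rmorphXn
  /= rmorph_nat.
Qed.

Lemma ideal_success_prob_sqr_le : p ^+ 2 <= 2 ^+ s * q.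
Proof.
have [ts fts e] := success_state_local_map.
have pE : p%:C
    = \sum_w (rand_prob P w)%:C * \sum_(t <- ts w) ideal_weight t.
  rewrite [LHS](success_probE EPR_density_posmx) (tr_success_state_sum _ e).
  by apply: eq_bigr => w _; rewrite tr_local_map_EPR.
have qE : q%:C
    = \sum_w (rand_prob P w)%:C * \sum_(t <- ts w) mixed_weight t.
  rewrite success_probE ?(tr_success_state_sum _ e);
    last exact: max_mixed_posmx.
  by apply: eq_bigr => w _; rewrite tr_local_map_mixed.
(* From here on the two probabilities are known only through their transcript sums. *)
move: p q pE qE => x y xE yE.
rewrite -lecR rmorphXn rmorphM /= xE yE.
have D0 : (0 < 2 ^ s)%N by rewrite expn_gt0.
have r0 w : 0 <= (rand_prob P w)%:C by rewrite ler0c rand_prob_ge0.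
apply: le_trans (mean_square_le D0 r0 rand_sum1 (fun w => (fts w).1)
  (fun=> @ideal_weight_ge0 _ _ _)) _.
rewrite natrX rmorphXn /= rmorph_nat ler_wpM2l ?exprn_ge0 ?ler0n //.
apply: ler_sum => w _; rewrite ler_wpM2l //.
rewrite !big_seq ler_sum // => t /(fts w).2[sA sB].
exact: ideal_weight_sqr_le.
Qed.

Lemma fidelity_mixed_le : (0 < m)%N -> fidelity (S mixed) <= q / 2.
Proof.
move=> m0; have pS := success_state_posmx (@max_mixed_posmx R (2 ^ n)).
rewrite -lecR fidelityE // rmorphM fmorphV rmorph_nat /= success_probE;
  last exact: max_mixed_posmx.
have [ts fts e] := success_state_local_map.
rewrite (tr_success_state_sum _ e) e mulmx_sumr mulmx_suml summxE mulr_suml.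
apply: ler_sum => w _; rewrite -scalemxAr -scalemxAl mxE -mulrA.
by rewrite ler_wpM2l ?ler0c ?rand_prob_ge0 // qform_local_map_mixed.
Qed.

Definition noisy (eps : R) : 'M[C]_(2 ^ n * 2 ^ n) :=
  (1 - eps)%:C *: EPR_density R n + eps%:C *: mixed.

Lemma noisy_model eps : 0 <= eps <= 1 -> fidelity_model n eps (noisy eps).
Proof.
move=> /andP[e0 e1]; split; last first.
  (* The ideal part alone contributes [1 - eps]; the mixed part adds a nonnegative amount. *)
  rewrite fidelityD !fidelityZ fidelity_EPR mulr1 lerDl mulr_ge0 //.
  by rewrite -ler0c fidelityE ?max_mixed_posmx //; apply: max_mixed_posmx.
have adjZ (a : R) (x : 'M[C]_(2 ^ n * 2 ^ n)) : (a%:C *: x) ^t* = a%:C *: x ^t*.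
  by rewrite linearZ map_mxZ /= conj_Creal // complex_real.
split; first split.
- rewrite linearD map_mxD /= !adjZ adjmxM trmxCK; congr (_ + _ *: _).
  exact: max_mixed_adj.
- move=> v; rewrite mulmxDr mulmxDl -!scalemxAr -!scalemxAl mxE.
  rewrite addr_ge0 // mxE mulr_ge0 ?ler0c ?subr_ge0 //.
    exact: EPR_density_posmx.
  exact: max_mixed_posmx.
- have trM : \tr mixed = 1.
    by rewrite tr_max_mixed // expn_gt0.
  have trE : \tr (EPR_density R n) = 1 by exact: frob_EPR.
  by rewrite mxtraceD !mxtraceZ trM trE !mulr1 -rmorphD /= subrK.
Qed.

Lemma success_prob_noisy eps : success_prob P (noisy eps)
  = (1 - eps) * p + eps * q.
Proof. by rewrite success_probD 2!success_probZ. Qed.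

Lemma fidelity_noisy eps : fidelity (S (noisy eps))
  = (1 - eps) * fidelity (S (EPR_density R n)) + eps * fidelity (S mixed).
Proof.
rewrite success_stateD 2!success_stateZ fidelityD.
by congr (_ + _); apply: fidelityZ.
Qed.

End Main.

Theorem theorem5 (R : realType) (n m s : nat) (eps p : R)
    (P : prob_protocol R n m s) :
  (1 <= n)%N -> (1 <= m)%N -> 0 <= eps <= 1 ->
  ideal_success_prob P = p ->
  cond_fidelity (fidelity_model n eps) P <= 1 - eps * p / 2 ^+ s.+1.
Proof.
move=> _ m0 he <-{p}; set p := ideal_success_prob P.
rewrite /cond_fidelity; set F := (X in inf X).
(* The lower bound 0 makes [inf F] a true infimum, so any single member of [F] bounds it from
   above. *)
have F_ge0 x : F x -> 0 <= x.
  move=> [rho [[[[_ prho] _] _] succ] <-].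
  rewrite fidelity_cond_output // divr_ge0 ?(ltW succ) //.
  exact/fidelity_ge0/success_state_posmx.
have infF x y : F x -> x <= y -> inf F <= y.
  by move=> Fx; apply: le_trans; apply: ge_inf => //; exists 0.
(* If [p = 0] the claimed bound is 1: either no state succeeds and the default value 1 applies, or
   any member of [F] is at most 1. *)
have [p0|p_gt0] : p <= 0 \/ 0 < p by case: leP; [left|right].
  have -> : p = 0 by apply/le_anti; rewrite p0 ideal_success_prob_ge0.
  rewrite mulr0 mul0r subr0; case: asboolP => // -[x Fx].
  apply: (infF x) => //; case: Fx => rho [[[[_ prho] _] _] succ] <-.
  rewrite fidelity_cond_output // ler_pdivrMr // mul1r.
  exact: fidelity_le_success_prob.
have hq := ideal_success_prob_sqr_le P; have hp := ideal_success_prob_le P.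
have nm := noisy_model n he; have pn : posmx (noisy n eps) by case: nm => -[[]].
(* A positive [p] forces success on the mixed state too, so [noisy] succeeds for every [eps],
   including [eps = 1]. *)
have q0 : 0 < success_prob P (max_mixed R (2 ^ n)).
  rewrite -(pmulr_rgt0 _ (exprn_gt0 s (ltr0n R 2))).
  by apply: lt_le_trans hq; rewrite exprn_gt0.
have succ : 0 < success_prob P (noisy n eps).
  by rewrite success_prob_noisy; exact: mixture_gt0 he p_gt0 q0.
have Fn : F (fidelity (cond_output P (noisy n eps))) by exists (noisy n eps).
case: asboolP => [_|[]]; last by eexists; exact: Fn.
apply: infF Fn _; rewrite fidelity_cond_output // success_prob_noisy.
(* [exprS] splits off the factor 2 of [mixture_bound], used with [D = 2 ^+ s]. *)
rewrite fidelity_noisy exprS; apply: (mixture_bound he p_gt0 hp hq).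
  exact/fidelity_le_success_prob/EPR_density_posmx.
exact: fidelity_mixed_le.
Qed.
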